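(* Consider a round-robin schedule, i.e. $k_{i,j}=k$ for all $i\ne j$, for some integer $k\ge1$. Let $\hat{\boldsymbol\theta}$ be the MAP estimate of the skills in the adjacent categories (AC) model with constant-sum slopes and a zero-mean Gaussian prior of precision $\gamma>0$, and let $s_i=\sum_y\delta_yk_{y;i}$ be the scores. Then every pair of players is schedule-equivalent, and: (a) if the model is venue-neutral, then $s_i\ge s_j\iff\hat\theta_i\ge\hat\theta_j$ for every $i,j=1,\dots,M$; (b) if the model has a home advantage and the schedule is moreover venue-balanced, i.e. $k^{\mathrm h}_{i,l}=k^{\mathrm a}_{i,l}=k/2$ for all $i\ne l$ (which requires $k$ to be even, the smallest case being the double round-robin $k=2$), then $s_i\ge s_j\iff\hat\theta_i\ge\hat\theta_j$ for every $i,j=1,\dots,M$. In both cases ranking by the scores and ranking by the exact MAP estimate are identical, ties included (that is, also $s_i=s_j\iff\hat\theta_i=\hat\theta_j$).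
   Context: Players $1,\dots,M$ with real skills $\theta_1,\dots,\theta_M$ play one-on-one matches, each having a host and a visitor. Outcomes lie in $\{0,\dots,L-1\}$, $L\ge2$; if the host's outcome is $y$, the visitor's is $L-1-y$. Counts. $k^{\mathrm h}_{y;i,j}$ is the number of matches hosted by $i$ against $j$ that ended in $i$'s outcome $y$; $k^{\mathrm a}_{y;i,j}=k^{\mathrm h}_{L-1-y;j,i}$ is the number of matches in which $i$ visited $j$ with $i$'s outcome $y$; $k_{y;i}=\sum_j(k^{\mathrm h}_{y;i,j}+k^{\mathrm a}_{y;i,j})$; $k^{\mathrm h}_{i,j}=\sum_yk^{\mathrm h}_{y;i,j}$; $k^{\mathrm a}_{i,j}=\sum_yk^{\mathrm a}_{y;i,j}=k^{\mathrm h}_{j,i}$; $k_{i,j}=k^{\mathrm h}_{i,j}+k^{\mathrm a}_{i,j}=k_{j,i}$. Schedule conditions. The pair $(i,j)$ is schedule-equivalent if $k_{i,l}=k_{j,l}$ for all $l\ne i,j$. The schedule is venue-balanced if $k^{\mathrm h}_{i,l}=k^{\mathrm a}_{i,l}$ for all $i,l$. AC model with constant-sum slopes. When $i$ hosts $j$, $i$'s outcome is $y$ with probability $\mathsf{P}^{\mathrm h}_y(\theta_i-\theta_j)$, where $$\mathsf{P}^{\mathrm h}_y(z)=\frac{e^{\alpha^{\mathrm h}_y+\delta_yz}}{\sum_{l=0}^{L-1}e^{\alpha^{\mathrm h}_l+\delta_lz}},$$ with given real intercepts $\alpha^{\mathrm h}_y$ and given slopes $0=\delta_0\le\delta_1\le\dots\le\delta_{L-1}=1$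 satisfying $\delta_y+\delta_{L-1-y}=1$ for all $y$. The away probabilities are $\mathsf{P}^{\mathrm a}_y(z)=\mathsf{P}^{\mathrm h}_{L-1-y}(-z)$. The model is venue-neutral if $\mathsf{P}^{\mathrm h}_y=\mathsf{P}^{\mathrm a}_y$ for all $y$; otherwise it is said to have a home advantage. The score-points are the slopes, so the score of player $i$ is $s_i=\sum_y\delta_yk_{y;i}$. MAP estimate. $\hat{\boldsymbol\theta}$ is the (unique) maximizer over $\boldsymbol\theta\in\mathbb{R}^M$ of $$\sum_{i,j}\sum_yk^{\mathrm h}_{y;i,j}\log\mathsf{P}^{\mathrm h}_y(\theta_i-\theta_j)-\frac{\gamma}{2}\sum_i\theta_i^2,\qquad\gamma>0.$$ *)

(* Defs.v *)
From HB Require Import structures.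
From mathcomp Require Import all_boot all_order all_algebra.
From mathcomp Require Import reals sequences exp.

Set Implicit Arguments.
Unset Strict Implicit.
Unset Printing Implicit Defensive.

Import Order.TTheory GRing.Theory Num.Theory.
Local Open Scope ring_scope.

(* Players are indexed by 'I_M and outcomes by 'I_L, so that the opponent's
   outcome L - 1 - y is rev_ord y.  [kh y i j] is the number of matches hosted
   by i against j in which i obtained the outcome y. *)
Section Counts.
Variables (L M : nat) (kh : 'I_L -> 'I_M -> 'I_M -> nat).

Definition no_self_match : Prop := forall y i, kh y i i = 0%N.

Definition ka (y : 'I_L) (i j : 'I_M) : nat := kh (rev_ord y) j i.

Definition outcome_count (y : 'I_L) (i : 'I_M) : nat :=
  (\sum_(j < M) (kh y i j + ka y i j))%N.

Definition hosted (i j : 'I_M) : nat := (\sum_(y < L) kh y i j)%N.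

Definition visited (i j : 'I_M) : nat := (\sum_(y < L) ka y i j)%N.

Definition matches (i j : 'I_M) : nat := (hosted i j + visited i j)%N.

Definition schedule_equivalent (i j : 'I_M) : Prop :=
  forall l, l != i -> l != j -> matches i l = matches j l.

Definition round_robin (k : nat) : Prop :=
  forall i j, i != j -> matches i j = k.

Definition venue_balanced : Prop := forall i l, hosted i l = visited i l.

End Counts.

Section Model.
Variables (R : realType) (L : nat) (alpha delta : 'I_L -> R).

Definition constant_sum_slopes : Prop :=
  [/\ forall y : 'I_L, y = 0%N :> nat -> delta y = 0,
      forall y : 'I_L, y = L.-1 :> nat -> delta y = 1,
      forall x y : 'I_L, (x <= y)%N -> delta x <= delta y
    & forall y : 'I_L, delta y + delta (rev_ord y) = 1].

Definition Ph (y : 'I_L) (z : R) : R :=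
  expR (alpha y + delta y * z) / \sum_(l < L) expR (alpha l + delta l * z).

Definition Pa (y : 'I_L) (z : R) : R := Ph (rev_ord y) (- z).

Definition venue_neutral : Prop := forall y, Ph y =1 Pa y.

Definition home_advantage : Prop := ~ venue_neutral.

Variables (M : nat) (kh : 'I_L -> 'I_M -> 'I_M -> nat).

Definition score (i : 'I_M) : R :=
  \sum_(y < L) delta y * (outcome_count kh y i)%:R.

Definition log_posterior (gamma : R) (theta : 'rV[R]_M) : R :=
  \sum_(i < M) \sum_(j < M) \sum_(y < L)
     (kh y i j)%:R * ln (Ph y (theta 0 i - theta 0 j))
  - gamma / 2 * \sum_(i < M) theta 0 i ^+ 2.

Definition is_MAP (gamma : R) (thetah : 'rV[R]_M) : Prop :=
  forall theta : 'rV[R]_M,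
    log_posterior gamma theta <= log_posterior gamma thetah.

End Model.

(* Main.v *)
Require Import Defs.
From mathcomp Require Import all_boot all_order all_algebra.
From mathcomp Require Import reals sequences exp.
From mathcomp Require Import boolp functions normedtype derive realfun.
From mathcomp Require Import ring lra.

Import Order.TTheory GRing.Theory Num.Theory numFieldNormedType.Exports.
Local Open Scope ring_scope.

(** The log-partition function of the outcome distribution has derivative the
    expected score E(z) of the host, and E is nondecreasing.  Stationarity of
    the log-posterior in the i-th skill therefore reads
      s_i = gamma theta_i + \sum_j (kh_ij E(theta_i - theta_j)
                                    + ka_ij (1 - E(theta_j - theta_i))).
    In a round-robin, if the model is neutral (E(z) + E(-z) = 1) or the schedule
    is balanced, the j-th summand is k/2 (1 + E(z) - E(-z)) with
    z = theta_i - theta_j.  Adding the missing summand j = i, which is the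
    constant k/2, gives s_i = F(theta_i) for one function F, the same for all
    players, and the prior term makes F strictly increasing. *)

(** * Log-partition function and monotonicity of the expected score *)

Section ExpectedScore.
Local Set Implicit Arguments.
Local Unset Strict Implicit.
Variables (R : realType) (L : nat) (alpha delta : 'I_L -> R).
Hypothesis L_gt0 : (0 < L)%N.

Definition weight (y : 'I_L) (z : R) : R := expR (alpha y + delta y * z).

Definition partition_function (z : R) : R := \sum_(y < L) weight y z.

Definition expected_score (z : R) : R :=
  \sum_(y < L) delta y * Ph alpha delta y z.

Lemma partition_function_gt0 z : 0 < partition_function z.
Proof.
rewrite /partition_function (bigD1 (Ordinal L_gt0)) //= ltr_wpDr ?expR_gt0 //.
by apply: sumr_ge0 => l _; apply/ltW/expR_gt0.
Qed.

Lemma sum_Ph z : \sum_(y < L) Ph alpha delta y z = 1.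
Proof.
rewrite /Ph -mulr_suml divff //; exact: lt0r_neq0 (partition_function_gt0 z).
Qed.

Lemma expected_scoreE z :
  expected_score z * partition_function z = \sum_(y < L) delta y * weight y z.
Proof.
rewrite mulr_suml; apply: eq_bigr => y _; rewrite -mulrA divfK //.
exact: lt0r_neq0 (partition_function_gt0 z).
Qed.

Lemma ln_Ph y z :
  ln (Ph alpha delta y z) = alpha y + delta y * z - ln (partition_function z).
Proof. by rewrite ln_div ?posrE ?expR_gt0 ?expRK ?partition_function_gt0. Qed.

Lemma is_derive_sum_fun n (f : 'I_n -> R -> R) (df : 'I_n -> R) x :
  (forall i, is_derive x (1 : R) (f i) (df i)) ->
  is_derive x (1 : R) (fun t => \sum_(i < n) f i t) (\sum_(i < n) df i).
Proof. by move=> fdf; rewrite -fct_sumE; exact: is_derive_sum. Qed.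

Lemma is_derive_affine (a b x : R) : is_derive x (1 : R) (fun t => a + b * t) b.
Proof.
have h : is_derive x (1 : R) (cst a + b \*: (@id R)) (0 + b *: 1).
  exact: is_deriveD.
by apply: is_derive_eq; rewrite add0r [_ *: _]mulr1.
Qed.

Lemma is_derive_ln_Ph y z :
  is_derive z (1 : R) (fun t => ln (Ph alpha delta y t))
    (delta y - expected_score z).
Proof.
have dw l : is_derive z (1 : R) (weight l) (delta l * weight l z).
  rewrite mulrC; apply: (is_derive1_comp (f := expR)).
  exact: is_derive_affine.
have dZ : is_derive z (1 : R) partition_function
    (\sum_(l < L) delta l * weight l z).
  exact: is_derive_sum_fun.
have dlnZ := is_derive1_comp (is_derive1_ln (partition_function_gt0 z)) dZ.
have := is_deriveB (is_derive_affine (alpha y) (delta y) z) dlnZ.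
(* The logarithmic derivative Z'/Z of the partition function is the mean slope, i.e. the expected
   score. *)
rewrite -expected_scoreE mulrCA mulVf ?lt0r_neq0 ?partition_function_gt0 //.
rewrite mulr1; by under [in X in _ -> X]eq_fun do rewrite ln_Ph.
Qed.

(* Exponentiated tangent-line inequality for the convex function
   ln partition_function, obtained from 1 + x <= expR x. *)
Lemma expected_score_tangent z h :
  partition_function z * expR (expected_score z * h) <=
  partition_function (z + h).
Proof.
set m := expected_score z * h.
(* Since [m] is the mean of [delta y * h] under the outcome distribution at [z], the deviations
   [delta y * h - m] average to zero. *)
have -> : partition_function z * expR m =
    \sum_(y < L) weight y z * (expR m * (1 + (delta y * h - m))).
  transitivity (expR m * ((1 - m) * partition_function z +
      h * \sum_(y < L) delta y * weight y z)).
    by rewrite -expected_scoreE /m; ring.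
  rewrite /partition_function !mulr_sumr -big_split /= mulr_sumr.
  by apply: eq_bigr => y _; ring.
apply: ler_sum => y _.
rewrite /weight [delta y * (z + h)]mulrDr [in leRHS]addrA [in leRHS]expRD.
rewrite ler_wpM2l ?expR_ge0 //.
rewrite -[X in _ <= expR X](subrKC m) expRD ler_wpM2l ?expR_ge0 //.
exact: expR_ge1Dx.
Qed.

(** Chaining the tangent inequalities at the two points cancels the partition functions and leaves
    (E(z) - E(z')) (z' - z) <= 0. *)
Lemma expected_score_nondecreasing : {homo expected_score : x y / x <= y}.
Proof.
move=> z z' le_zz'.
have [-> // | neq_zz'] := eqVneq z z'.
have lt_zz' : 0 < z' - z by rewrite subr_gt0 lt_neqAle neq_zz'.
have := expected_score_tangent z (z' - z); rewrite subrKC => le1.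
have := expected_score_tangent z' (z - z'); rewrite subrKC => le2.
have := partition_function_gt0 z => Z_gt0.
have : expR (expected_score z * (z' - z)) *
       expR (expected_score z' * (z - z')) <= 1.
  rewrite -(ler_pM2l Z_gt0) mulr1 mulrA; apply: le_trans le2.
  by rewrite ler_wpM2r ?expR_ge0.
rewrite -expRD -expR0 ler_expR -[z - z']opprB mulrN -mulrBl.
by rewrite pmulr_lle0 // subr_le0.
Qed.

(** The sum on the right is the visitor's expected score, and the two scores of a match add up to
    1. *)
Lemma expected_score_rev z : (forall y, delta y + delta (rev_ord y) = 1) ->
  expected_score z = 1 - \sum_(y < L) delta y * Pa alpha delta y (- z).
Proof.
move=> delta_rev; rewrite -(sum_Ph z) [X in _ - X](reindex_inj rev_ord_inj) /=.
rewrite -sumrB; apply: eq_bigr => y _.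
by rewrite /Pa rev_ordK opprK -[X in X - _]mul1r -(delta_rev y); ring.
Qed.

Lemma expected_score_neutral z : (forall y, delta y + delta (rev_ord y) = 1) ->
  venue_neutral alpha delta -> expected_score z + expected_score (- z) = 1.
Proof.
move=> delta_rev neutral; rewrite (expected_score_rev z delta_rev).
rewrite -[RHS](subrK (expected_score (- z))); congr (1 - _ + _).
by apply: eq_bigr => y _; rewrite neutral.
Qed.

End ExpectedScore.

(** * Gradient of the log-posterior and the score equation *)

Section Stationarity.
Local Set Implicit Arguments.
Local Unset Strict Implicit.
Variables (R : realType) (L M : nat) (alpha delta : 'I_L -> R).
Variables (kh : 'I_L -> 'I_M -> 'I_M -> nat) (gamma : R).
Hypothesis L_gt0 : (0 < L)%N.

Local Notation E := (expected_score alpha delta).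

(** Residual of [a] as host of [b]: observed minus expected score. *)
Definition host_excess (theta : 'rV[R]_M) (a b : 'I_M) : R :=
  \sum_(y < L) (kh y a b)%:R * (delta y - E (theta 0 a - theta 0 b)).

Definition log_posterior_partial (theta : 'rV[R]_M) (i : 'I_M) : R :=
  \sum_(j < M) (host_excess theta i j - host_excess theta j i)
  - gamma * theta 0 i.

Lemma is_derive_log_posterior (theta : 'rV[R]_M) i t :
  let line u := theta + u *: delta_mx 0 i in
  is_derive t (1 : R) (fun u => log_posterior alpha delta kh gamma (line u))
    (log_posterior_partial (line t) i).
Proof.
move=> line.
(* Along [line], the [a]-th skill is affine with slope [e a], so each skill difference has slope
   [e a - e b]. *)
pose e a : R := (a == i)%:R.
have lineE u a : line u 0 a = theta 0 a + e a * u.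
  by rewrite !mxE eqxx mulrC.
have dll : is_derive t (1 : R)
    (fun u => \sum_a \sum_b \sum_(y < L) (kh y a b)%:R *
                ln (Ph alpha delta y (line u 0 a - line u 0 b)))
    (\sum_a \sum_b \sum_(y < L) (kh y a b)%:R *
       ((delta y - E (line t 0 a - line t 0 b)) * (e a - e b))).
  apply: is_derive_sum_fun => a; apply: is_derive_sum_fun => b.
  apply: is_derive_sum_fun => y; apply: is_deriveZ.
  have -> : (fun u => ln (Ph alpha delta y (line u 0 a - line u 0 b))) =
      (fun z => ln (Ph alpha delta y z)) \o
      (fun u => (theta 0 a - theta 0 b) + (e a - e b) * u).
    by apply/funext => u /=; rewrite !lineE; congr (ln (Ph _ _ _ _)); ring.
  have -> : line t 0 a - line t 0 b =
      (theta 0 a - theta 0 b) + (e a - e b) * t by rewrite !lineE; ring.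
  by apply: is_derive1_comp; [exact: is_derive_ln_Ph | exact: is_derive_affine].
have dprior : is_derive t (1 : R)
    (fun u => gamma / 2 * \sum_a line u 0 a ^+ 2)
    (gamma / 2 * \sum_a (2 * line t 0 a * e a)).
  apply: is_deriveZ; apply: is_derive_sum_fun => a.
  have -> : (fun u => line u 0 a ^+ 2) = (fun u => theta 0 a + e a * u) ^+ 2.
    by apply/funext => u; rewrite lineE.
  rewrite lineE; apply: is_deriveX; exact: is_derive_affine.
have := is_deriveB dll dprior.
congr is_derive; rewrite /log_posterior_partial; congr (_ - _); last first.
  rewrite (bigD1 i) //= big1 => [|a /negPf ai]; last by rewrite /e ai mulr0.
  by rewrite /e eqxx addr0 mulr1; field.
rewrite sumrB.
(* The indicators [e a] and [e b] then select the matches hosted by [i] and those visited by [i]. *)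
transitivity (\sum_a \sum_b (host_excess (line t) a b * e a
                             - host_excess (line t) a b * e b)).
  apply: eq_bigr => a _; apply: eq_bigr => b _.
  by rewrite -mulrBr mulr_suml; apply: eq_bigr => y _; rewrite mulrA.
under eq_bigr do rewrite sumrB.
rewrite sumrB; congr (_ - _).
  rewrite (bigD1 i) //= [X in _ + X]big1 => [|a /negPf ai].
    by rewrite addr0; apply: eq_bigr => b _; rewrite /e eqxx mulr1.
  by apply: big1 => b _; rewrite /e ai mulr0.
apply: eq_bigr => a _; rewrite (bigD1 i) //= big1 => [|b /negPf bi].
  by rewrite /e eqxx mulr1 addr0.
by rewrite /e bi mulr0.
Qed.

Lemma MAP_stationary (theta : 'rV[R]_M) i :
  is_MAP alpha delta kh gamma theta -> log_posterior_partial theta i = 0.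
Proof.
move=> MAPtheta; pose line u := theta + u *: delta_mx 0 i : 'rV[R]_M.
have line0 : line 0 = theta by rewrite /line scale0r addr0.
have dline t := is_derive_log_posterior theta i t.
have d0 : is_derive 0 (1 : R)
    (fun u => log_posterior alpha delta kh gamma (line u)) 0.
  (* Fermat's rule along the coordinate line; any open interval around 0 would do. *)
  apply: (@derive1_at_max R _ (-1) 1).
  - lra.
  - by move=> t _; have [] := dline t.
  - by rewrite in_itv /=; lra.
  - by move=> t _; rewrite line0.
by rewrite -[in LHS]line0 -(@derive_val _ _ _ _ _ _ _ (dline 0)) derive_val.
Qed.

Lemma visitedE i j : visited kh i j = hosted kh j i.
Proof. by rewrite /visited /hosted [RHS](reindex_inj rev_ord_inj). Qed.

Lemma MAP_score (theta : 'rV[R]_M) i :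
  (forall y, delta y + delta (rev_ord y) = 1) ->
  is_MAP alpha delta kh gamma theta ->
  score delta kh i = gamma * theta 0 i +
    \sum_(j < M) ((hosted kh i j)%:R * E (theta 0 i - theta 0 j) +
                  (visited kh i j)%:R * (1 - E (theta 0 j - theta 0 i))).
Proof.
move=> delta_rev /(@MAP_stationary _ i) /eqP.
rewrite subr_eq0 => /eqP <-.
rewrite -big_split /=.
transitivity (\sum_(j < M) \sum_(y < L)
    (delta y * (kh y i j)%:R + delta y * (ka kh y i j)%:R)).
  rewrite exchange_big; apply: eq_bigr => y _.
  rewrite /outcome_count natr_sum mulr_sumr.
  by apply: eq_bigr => j _; rewrite natrD mulrDr.
apply: eq_bigr => j _.
(* Away matches are re-indexed by the host's outcome, so that the visitor earns [1 - delta y]. *)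
rewrite big_split /= [X in _ + X](reindex_inj rev_ord_inj) /=.
rewrite /host_excess visitedE /hosted !natr_sum !mulr_suml.
rewrite -sumrB -!big_split /=; apply: eq_bigr => y _.
rewrite /ka rev_ordK.
have -> : delta (rev_ord y) = 1 - delta y by rewrite -(delta_rev y); ring.
ring.
Qed.

End Stationarity.

(** * Round-robin schedules: scores as a function of skill *)

Section RoundRobin.
Local Set Implicit Arguments.
Local Unset Strict Implicit.
Variables (R : realType) (L M : nat) (alpha delta : 'I_L -> R).
Variables (kh : 'I_L -> 'I_M -> 'I_M -> nat) (k : nat) (gamma : R).
Hypothesis L_gt0 : (0 < L)%N.
Hypotheses (delta_rev : forall y, delta y + delta (rev_ord y) = 1).
Hypotheses (kh_self : no_self_match kh) (kh_rr : round_robin kh k).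
Hypothesis gamma_gt0 : 0 < gamma.

Local Notation E := (expected_score alpha delta).

Lemma hosted_self i : hosted kh i i = 0%N.
Proof. by apply: big1 => y _; exact: kh_self. Qed.

Lemma round_robin_schedule_equivalent i j : schedule_equivalent kh i j.
Proof. by move=> l li lj; rewrite !kh_rr // eq_sym. Qed.

Lemma venue_balanced_half i j : venue_balanced kh -> i != j ->
  (hosted kh i j).*2 = k.
Proof. by move=> balanced /kh_rr; rewrite /matches -balanced addnn. Qed.

(** In the neutral case both sides equal k E(z), whatever the split between venues; in the balanced
    case both counts are k/2. *)
Lemma match_term i j z : i != j ->
  venue_neutral alpha delta \/ venue_balanced kh ->
  (hosted kh i j)%:R * E z + (visited kh i j)%:R * (1 - E (- z)) =
  k%:R / 2 * (1 + (E z - E (- z))).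
Proof.
move=> ij [neutral | balanced].
  have := expected_score_neutral L_gt0 z delta_rev neutral => Ez.
  have -> : E (- z) = 1 - E z by rewrite -Ez; ring.
  by rewrite -(kh_rr ij) natrD; field.
by rewrite -balanced -(venue_balanced_half balanced ij) -addnn natrD; field.
Qed.

(** The sum includes the player's own index, so that the function is common to all players; the
    final [- k%:R / 2] compensates for it at [t = theta 0 i]. *)
Definition score_of_skill (theta : 'rV[R]_M) (t : R) : R :=
  gamma * t + \sum_(j < M)
    k%:R / 2 * (1 + (E (t - theta 0 j) - E (theta 0 j - t))) - k%:R / 2.

Lemma score_of_skill_increasing theta :
  {homo score_of_skill theta : x y / x < y}.
Proof.
move=> x y lt_xy; rewrite /score_of_skill ltrD2r ltr_leD ?ltr_pM2l //.
apply: ler_sum => j _; rewrite ler_wpM2l ?divr_ge0 ?ler0n //.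
rewrite lerD2l lerB // expected_score_nondecreasing //.
  by rewrite lerD2r ltW.
by rewrite lerD2l lerN2 ltW.
Qed.

Lemma MAP_score_of_skill theta i :
  is_MAP alpha delta kh gamma theta ->
  venue_neutral alpha delta \/ venue_balanced kh ->
  score delta kh i = score_of_skill theta (theta 0 i).
Proof.
move=> MAPtheta hyp.
rewrite (MAP_score L_gt0 i delta_rev MAPtheta) /score_of_skill -addrA.
congr (_ + _); rewrite (bigD1 i) //= [in RHS](bigD1 i) //=.
(* The summand [j = i] vanishes on the left, and on the right cancels against [k%:R / 2]. *)
rewrite visitedE hosted_self !subrr addr0 mulr1 !mul0r !add0r addrAC.
rewrite subrr add0r.
by apply: eq_bigr => j ji; rewrite -(opprB (theta 0 i)) match_term // eq_sym.
Qed.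

Lemma MAP_ranking theta i j :
  is_MAP alpha delta kh gamma theta ->
  venue_neutral alpha delta \/ venue_balanced kh ->
  (score delta kh i >= score delta kh j <-> theta 0 i >= theta 0 j)
  /\ (score delta kh i = score delta kh j <-> theta 0 i = theta 0 j).
Proof.
move=> MAPtheta hyp; rewrite !(MAP_score_of_skill _ MAPtheta hyp).
(* On a total order, strict increase reflects the order and gives injectivity, which settles
   ties. *)
have mono := le_mono (@score_of_skill_increasing theta).
rewrite mono; split=> //; split=> [|-> //].
exact: inc_inj mono _ _.
Qed.

End RoundRobin.

Theorem corollary1 (R : realType) (L M : nat) (alpha delta : 'I_L -> R)
    (kh : 'I_L -> 'I_M -> 'I_M -> nat) (k : nat) (gamma : R)
    (thetah : 'rV[R]_M)
    (hL : (2 <= L)%N) (hdelta : constant_sum_slopes delta)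
    (hself : no_self_match kh) (hk : (1 <= k)%N) (hrr : round_robin kh k)
    (hgamma : 0 < gamma) (hMAP : is_MAP alpha delta kh gamma thetah) :
  [/\ forall i j : 'I_M, schedule_equivalent kh i j,
      venue_neutral alpha delta ->
        forall i j : 'I_M,
          (score delta kh i >= score delta kh j <-> thetah 0 i >= thetah 0 j)
          /\ (score delta kh i = score delta kh j <-> thetah 0 i = thetah 0 j)
    & home_advantage alpha delta -> venue_balanced kh ->
        (forall i l : 'I_M, i != l ->
           [/\ ~~ odd k, hosted kh i l = k./2 & visited kh i l = k./2])
        /\ forall i j : 'I_M,
          (score delta kh i >= score delta kh j <-> thetah 0 i >= thetah 0 j)
          /\ (score delta kh i = score delta kh j <-> thetah 0 i = thetah 0 j)].
Proof.
have L_gt0 : (0 < L)%N by exact: ltnW hL.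
have [_ _ _ delta_rev] := hdelta.
have ranking i j := MAP_ranking L_gt0 delta_rev hself hrr hgamma i j hMAP.
split=> [i j | neutral i j | _ balanced].
- exact: round_robin_schedule_equivalent hrr _ _.
- by apply: ranking; left.
split=> [i l il | i j]; last by apply: ranking; right.
(* Writing [k] as a double settles its parity and both halves at once. *)
rewrite -balanced -(venue_balanced_half hrr balanced il).
by rewrite odd_double doubleK.
Qed.
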